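(* Let $n,j\in\mathbb{N}$. For each $i\in[j]$ let $r_i>0$, let $2\le k_i\le n+1$, let $U_i:=\{u^i_1,\dots,u^i_{k_i}\}\subset r_i\mathbb{S}^{n-1}$, and let $\lambda^i_1,\dots,\lambda^i_{k_i}>0$. Let $c\in\mathbb{R}^n$. Suppose that $$0=\sum_{l=1}^{k_1}\lambda^1_l u^1_l=\cdots=\sum_{l=1}^{k_j}\lambda^j_l u^j_l .$$ Then $$\max_{l_1\in[k_1],\dots,l_j\in[k_j]}\left\|u^1_{l_1}+\cdots+u^j_{l_j}-c\right\|_2\ \ge\ \sqrt{r_1^2+\cdots+r_j^2}.$$ Moreover, equality holds if and only if $c=0$, $j\in[n]$, and $U_k$ and $U_l$ are mutually orthogonal for every choice $1\le k<l\le j$.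
   Context: For $m\in\mathbb{N}$, $[m]:=\{1,\dots,m\}$. $\|\cdot\|_2$ is the Euclidean norm on $\mathbb{R}^n$, $\mathbb{S}^{n-1}=\{x\in\mathbb{R}^n:\|x\|_2=1\}$, and $r\mathbb{S}^{n-1}$ is the sphere of radius $r$ centred at the origin. Two sets $K,L\subset\mathbb{R}^n$ are mutually orthogonal if $x^Ty=0$ for every $x\in K$ and $y\in L$. *)

(* Defs.v *)
From mathcomp Require Import all_boot all_order all_algebra.
From mathcomp Require Import classical_sets reals.

Set Implicit Arguments.
Unset Strict Implicit.
Unset Printing Implicit Defensive.

Import Order.TTheory GRing.Theory Num.Theory.
Local Open Scope ring_scope.
Local Open Scope classical_set_scope.

(* The norm `|x| that MathComp-Analysis puts on matrices is the sup norm, so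
   the Euclidean norm is defined here. *)
Definition enorm (R : realType) (n : nat) (x : 'cV[R]_n) : R :=
  Num.sqrt (\sum_(p < n) x p ord0 ^+ 2).

Definition esphere (R : realType) (n : nat) (r : R) : set 'cV[R]_n :=
  [set x | enorm x = r].

Definition mutually_orthogonal (R : realType) (n : nat) (K L : set 'cV[R]_n) :
    Prop :=
  forall x y : 'cV[R]_n, K x -> L y -> x^T *m y = 0.

(* A choice of one index l_i in [k_i] for every i in [j] is an element l of the
   dependent product below. The default value 0 of the iterated maximum is
   harmless: norms are nonnegative, and the index set is nonempty as soon as all
   the k i are positive. *)
Definition max_dist (R : realType) (n j : nat) (k : 'I_j -> nat)
    (u : forall i : 'I_j, 'I_(k i) -> 'cV[R]_n) (c : 'cV[R]_n) : R :=
  \big[Num.max/0]_(l : {dffun forall i : 'I_j, 'I_(k i)})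
    enorm ((\sum_(i < j) u i (l i)) - c).

(* Main.v *)
(* Since 0 is a positive combination of U_i, every vector v makes a nonnegative
   inner product with some element of U_i, and a positive one as soon as v is
   not orthogonal to U_i.  Starting from -c and adding greedily one vector of
   each U_i, the squared norm grows by at least r_i^2 at each step, so the
   squared maximum is at least |c|^2 + sum r_i^2.  If U_a and U_b are not
   orthogonal, starting instead from x + y with x in U_a, y in U_b and x.y > 0
   makes the inequality strict.  Conversely, Pythagoras' theorem gives equality,
   and j <= n because nonzero pairwise orthogonal vectors are independent. *)
Require Import Defs.
From mathcomp Require Import all_boot all_order all_algebra.
From mathcomp Require Import classical_sets reals.

Set Implicit Arguments.
Unset Strict Implicit.
Unset Printing Implicit Defensive.

Import Order.TTheory GRing.Theory Num.Theory.
Local Open Scope ring_scope.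
Local Open Scope classical_set_scope.

Section DotProduct.
Context {R : realType} {n : nat}.
Implicit Types x y z : 'cV[R]_n.

Definition dot x y : R := (x^T *m y) ord0 ord0.

Lemma dotE x y : dot x y = \sum_p x p ord0 * y p ord0.
Proof. by rewrite /dot mxE; apply: eq_bigr => p _; rewrite mxE. Qed.

Lemma dotC x y : dot x y = dot y x.
Proof. by rewrite !dotE; apply: eq_bigr => p _; rewrite mulrC. Qed.

Lemma dotDr x y z : dot x (y + z) = dot x y + dot x z.
Proof. by rewrite /dot mulmxDr mxE. Qed.

Lemma dotZr a x y : dot x (a *: y) = a * dot x y.
Proof. by rewrite /dot -scalemxAr mxE. Qed.

Lemma dot_sumr (I : finType) x (w : I -> 'cV[R]_n) :
  dot x (\sum_i w i) = \sum_i dot x (w i).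
Proof. by rewrite /dot mulmx_sumr summxE. Qed.

Lemma dot_sqD x y : dot (x + y) (x + y) = dot x x + dot y y + dot x y *+ 2.
Proof.
rewrite dotDr (dotC (x + y) x) (dotC (x + y) y) !dotDr (dotC y x) mulr2n.
by rewrite addrACA [dot x y + dot y y]addrC [RHS]addrAC !addrA addrAC.
Qed.

Lemma dot_sqN x : dot (- x) (- x) = dot x x.
Proof. by rewrite !dotE; apply: eq_bigr => p _; rewrite !mxE mulrNN. Qed.

Lemma dot_sq_ge0 x : 0 <= dot x x.
Proof. by rewrite dotE sumr_ge0// => p _; rewrite -expr2 sqr_ge0. Qed.

Lemma dot_sq_eq0 x : dot x x = 0 -> x = 0.
Proof.
rewrite dotE => /psumr_eq0P h; apply/matrixP => p q; rewrite ord1 mxE.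
by apply/eqP; rewrite -sqrf_eq0 expr2 h// => s _; rewrite -expr2 sqr_ge0.
Qed.

Lemma enormE x : enorm x = Num.sqrt (dot x x).
Proof. by rewrite /enorm dotE; congr Num.sqrt; apply: eq_bigr. Qed.

Lemma mutually_orthogonalP (K L : set 'cV[R]_n) :
  mutually_orthogonal K L <-> forall x y, K x -> L y -> dot x y = 0.
Proof.
split=> [h x y Kx Ly|h x y Kx Ly]; first by rewrite /dot h// mxE.
by apply/matrixP => p q; rewrite !ord1 [RHS]mxE; exact: h.
Qed.

Lemma pythagoras (I : finType) (w : I -> 'cV[R]_n) :
  (forall a b, a != b -> dot (w a) (w b) = 0) ->
  dot (\sum_i w i) (\sum_i w i) = \sum_i dot (w i) (w i).
Proof.
move=> h; rewrite dot_sumr; apply: eq_bigr => i _.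
rewrite dotC dot_sumr (bigD1 i)//= big1 ?addr0// => i' ne.
by rewrite h// eq_sym.
Qed.

(** The Gram matrix of the family is diagonal with nonzero entries, so it has rank [j]; as a product
    through a matrix with [n] columns, its rank is at most [n]. *)
Lemma orthogonal_card_le (j : nat) (w : 'I_j -> 'cV[R]_n) :
  (forall a b, a != b -> dot (w a) (w b) = 0) ->
  (forall a, dot (w a) (w a) != 0) -> (j <= n)%N.
Proof.
move=> orth nz; pose A := \matrix_(a < j, p < n) w a p ord0.
have gram : A *m A^T = diag_mx (\row_a dot (w a) (w a)).
  apply/matrixP => a b; rewrite !mxE; under eq_bigr do rewrite !mxE.
  rewrite -dotE; have [->|ne] := eqVneq a b; first by rewrite mulr1n.
  by rewrite mulr0n orth.
have gram_unit : A *m A^T \in unitmx.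
  rewrite unitmxE gram det_diag unitfE prodf_seq_neq0; apply/allP => a _.
  by rewrite mxE nz.
by rewrite -(mxrank_unit gram_unit) (leq_trans (mxrankM_maxl _ _))// rank_leq_col.
Qed.

Section Balanced.
Context {m : nat} (f : 'I_m -> 'cV[R]_n) (lambda : 'I_m -> R).
Hypothesis lambda_gt0 : forall l, 0 < lambda l.
Hypothesis balanced : 0 = \sum_l lambda l *: f l.

Lemma balanced_dot v : \sum_l lambda l * dot v (f l) = 0.
Proof.
under eq_bigr do rewrite -dotZr.
by rewrite -dot_sumr -balanced /dot mulmx0 mxE.
Qed.

(** The inner products with [v], weighted by the positive [lambda l], sum to zero. If none were
    positive, all would have to vanish, including the one at [l0]. *)
Lemma balanced_dot_gt0 v l0 : dot v (f l0) != 0 -> exists l, 0 < dot v (f l).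
Proof.
move=> nz; apply/existsP; apply: contraNT nz; rewrite negb_exists => /forallP h.
have le0 l : 0 <= - (lambda l * dot v (f l)).
  by rewrite oppr_ge0 pmulr_rle0// leNgt.
have /psumr_eq0P/(_ l0 isT)/eqP : \sum_l - (lambda l * dot v (f l)) = 0.
  by rewrite sumrN balanced_dot oppr0.
by rewrite oppr_eq0 mulf_eq0 gt_eqF//= => ->.
Qed.

Lemma balanced_dot_ge0 v : (0 < m)%N -> exists l, 0 <= dot v (f l).
Proof.
move=> m_gt0; have [e|/balanced_dot_gt0[l /ltW]] :=
  eqVneq (dot v (f (Ordinal m_gt0))) 0; last by exists l.
by exists (Ordinal m_gt0); rewrite e.
Qed.

End Balanced.

(** Choosing [x] with [0 <= dot v x] makes the cross term in the expansion of the square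
    nonnegative, so each index of [s] contributes at least [rho i]. Outside [s] the choice is
    prescribed by [w0], which allows some vectors to be fixed in advance. *)
Lemma greedy_sum (I : finType) (U : I -> set 'cV[R]_n) (rho : I -> R) :
  (forall i x, U i x -> dot x x = rho i) ->
  (forall i v, exists2 x, U i x & 0 <= dot v x) ->
  forall (w0 : I -> 'cV[R]_n) (s : seq I) v,
    (forall i, U i (w0 i)) -> uniq s ->
  exists w : I -> 'cV[R]_n,
    [/\ forall i, U i (w i), forall i, i \notin s -> w i = w0 i &
        dot v v + \sum_(i <- s) rho i <=
        dot (v + \sum_(i <- s) w i) (v + \sum_(i <- s) w i)].
Proof.
move=> Urho Uge0 w0 s v Uw0; elim: s v => [|i s IH] v /=.
  by move=> _; exists w0; rewrite !big_nil !addr0.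
move=> /andP[is_ us]; have [x Ux vx] := Uge0 i v.
have [w [Uw ww0 hw]] := IH (v + x) us.
exists (fun i' => if i' == i then x else w i'); split.
- by move=> i'; case: eqP => [->|_].
- by move=> i'; rewrite inE negb_or => /andP[/negPf-> /ww0].
rewrite !big_cons eqxx !addrA.
(* Since [i] does not occur in [s], overriding [w] at [i] leaves the sum over [s] unchanged. *)
rewrite (@eq_big_seq _ _ _ _ s (fun i' => if i' == i then x else w i') w); last first.
  by move=> i' i's; case: eqP => // e; rewrite -e i's in is_.
apply: le_trans hw; rewrite lerD2r dot_sqD (Urho i x)//.
by rewrite lerDl mulrn_wge0.
Qed.

End DotProduct.

(** This lets later arguments choose vectors instead of dependent indices; finite choice recovers an
    index for each vector. *)
Lemma enorm_le_max_dist (R : realType) (n j : nat) (k : 'I_j -> nat)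
    (u : forall i : 'I_j, 'I_(k i) -> 'cV[R]_n) (c : 'cV[R]_n)
    (w : 'I_j -> 'cV[R]_n) :
  (forall i, range (u i) (w i)) -> enorm (\sum_i w i - c) <= max_dist u c.
Proof.
move=> uw; have /fin_all_exists[l wl] : forall i, exists l, u i l = w i.
  by move=> i; have [l _ <-] := uw i; exists l.
rewrite (_ : \sum_i w i = \sum_i u i ((finfun l : {dffun _}) i)).
  exact: (le_bigmax _ (fun l : {dffun forall i : 'I_j, 'I_(k i)} =>
    enorm ((\sum_(i < j) u i (l i)) - c))).
by apply: eq_bigr => i _; rewrite ffunE wl.
Qed.

Theorem theorem1p1 (R : realType) (n j : nat) (n_gt0 : (0 < n)%N)
    (j_gt0 : (0 < j)%N) (r : 'I_j -> R) (k : 'I_j -> nat)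
    (u : forall i : 'I_j, 'I_(k i) -> 'cV[R]_n)
    (lambda : forall i : 'I_j, 'I_(k i) -> R) (c : 'cV[R]_n)
    (r_gt0 : forall i : 'I_j, 0 < r i)
    (k_bounds : forall i : 'I_j, (2 <= k i <= n.+1)%N)
    (u_sphere : forall i : 'I_j, range (u i) `<=` @esphere R n (r i))
    (lambda_gt0 : forall (i : 'I_j) (l : 'I_(k i)), 0 < lambda i l)
    (balanced : forall i : 'I_j, 0 = \sum_(l < k i) lambda i l *: u i l) :
  (Num.sqrt (\sum_(i < j) r i ^+ 2) <= max_dist u c) /\
  (max_dist u c = Num.sqrt (\sum_(i < j) r i ^+ 2) <->
   [/\ c = 0,
       (1 <= j <= n)%N &
       forall a b : 'I_j, (a < b)%N ->
         mutually_orthogonal (range (u a)) (range (u b))]).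
Proof.
have k_gt0 i : (0 < k i)%N by case/andP: (k_bounds i) => /ltnW.
have sq i x : range (u i) x -> dot x x = r i ^+ 2.
  by move=> /u_sphere; rewrite /esphere /= enormE => <-; rewrite sqr_sqrtr ?dot_sq_ge0.
have ge0 i v : exists2 x, range (u i) x & 0 <= dot v x.
  have [l hl] := balanced_dot_ge0 (lambda_gt0 i) (balanced i) v (k_gt0 i).
  by exists (u i l) => //; exists l.
pose w0 i := u i (Ordinal (k_gt0 i)).
have Uw0 i : range (u i) (w0 i) by exists (Ordinal (k_gt0 i)).
have S_ge0 : 0 <= \sum_(i < j) r i ^+ 2 by apply: sumr_ge0 => i _; exact: sqr_ge0.
(* The term [dot c c] is kept because, in the equality case, it forces [c = 0]. *)
have lower : Num.sqrt (dot c c + \sum_(i < j) r i ^+ 2) <= max_dist u c.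
  have [w [Uw _ hw]] := greedy_sum sq ge0 (- c) Uw0 (index_enum_uniq 'I_j).
  apply: le_trans (enorm_le_max_dist c Uw); rewrite enormE ler_wsqrtr//.
  by rewrite [_ - c]addrC -(dot_sqN c).
have bound : Num.sqrt (\sum_(i < j) r i ^+ 2) <= max_dist u c.
  by apply: le_trans lower; rewrite ler_wsqrtr// lerDr dot_sq_ge0.
split=> //; split=> [maxE|[c0 _ orth]].
- have c0 : c = 0.
    apply/dot_sq_eq0/le_anti; rewrite dot_sq_ge0 andbT.
    by move: lower; rewrite maxE ler_sqrt// gerDr.
  have orth a b : a != b -> forall x y, range (u a) x -> range (u b) y -> dot x y = 0.
    move=> ab x y Ux [l _ <-]; apply/eqP; apply: contraT => nz.
    have [l' pos] := balanced_dot_gt0 (lambda_gt0 b) (balanced b) nz.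
    pose w1 i := if i == a then x else if i == b then u b l' else w0 i.
    have Uw1 i : range (u i) (w1 i).
      rewrite /w1; case: eqP => [->//|_]; case: eqP => [->|_ //].
      by exists l'.
    (* The greedy choice runs only over the indices other than [a] and [b], so [x] and [u b l'] stay
       in the final sum. *)
    have us : uniq [seq i <- index_enum 'I_j | (i != a) && (i != b)].
      by rewrite filter_uniq ?index_enum_uniq.
    have [w [Uw ww1 hw]] := greedy_sum sq ge0 (x + u b l') Uw1 us.
    have split_ab (V : nmodType) (F : 'I_j -> V) :
        \sum_i F i = F a + F b + \sum_(i | (i != a) && (i != b)) F i.
      by rewrite (bigD1 a)//= (bigD1 b) 1?eq_sym//= addrA.
    have wa : w a = x by rewrite ww1 ?mem_filter ?eqxx// /w1 eqxx.
    have wb : w b = u b l'.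
      by rewrite ww1 ?mem_filter ?eqxx ?andbF// /w1 eq_sym (negPf ab) eqxx.
    have := enorm_le_max_dist c Uw; rewrite maxE enormE ler_sqrt// c0 subr0.
    rewrite !split_ab wa wb leNgt => /negP[]; rewrite !big_filter in hw.
    (* The strict gain is twice [dot x (u b l')], which contradicts equality. *)
    apply: lt_le_trans hw; rewrite ltrD2r dot_sqD (sq a x)// (sq b (u b l')).
      by rewrite ltrDl pmulrn_lgt0.
    by exists l'.
  split=> //.
    (* One vector from each set gives [j] pairwise orthogonal vectors, nonzero since the radii are
       positive. *)
    rewrite j_gt0; apply: (@orthogonal_card_le R n j w0) => [a b ab|a].
      exact: (orth a b).
    by rewrite (sq a)// sqrf_eq0 gt_eqF.
  by move=> a b ab; apply/mutually_orthogonalP/orth; rewrite neq_ltn ab.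
- apply/le_anti; rewrite bound andbT.
  (* The default value 0 of the maximum must satisfy the bound too. *)
  apply: bigmax_le => [|l _]; first exact: sqrtr_ge0.
  rewrite enormE c0 subr0 ler_wsqrtr// pythagoras => [|a b].
    by apply: ler_sum => i _; rewrite (sq i)//; exists (l i).
  (* Orthogonality is given only for [a < b]; the other order follows by symmetry of [dot]. *)
  rewrite neq_ltn => /orP[] ab.
    by apply: ((mutually_orthogonalP _ _).1 (orth a b ab)); eexists.
  by rewrite dotC; apply: ((mutually_orthogonalP _ _).1 (orth b a ab)); eexists.
Qed.
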